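(* Let $n,p\ge 1$, let $f_1,\dots,f_n:\mathbb{R}^p\to\mathbb{R}$ and mixing matrices $W,\tilde W\in\mathbb{R}^{n\times n}$ satisfy Assumptions 1, 2 and 3 listed in the context, and let $L_{\mathbf f}=\max_i L_{f_i}$. Let $\{\mathbf{x}^k\}_{k\ge0}$ be generated by EXTRA with step size $\alpha$ from an arbitrary starting point $\mathbf{x}^0\in\mathbb{R}^{n\times p}$, and let $\mathbf{q}^k$, $\mathbf{z}^k$, $G$ be as defined in the context. If $$0<\alpha<\frac{2\lambda_{\min}(\tilde W)}{L_{\mathbf f}},$$ then for every optimal $\mathbf{z}^*=\begin{pmatrix}\mathbf{q}^*\\ \mathbf{x}^*\end{pmatrix}$ (i.e. every pair $\mathbf{q}^*,\mathbf{x}^*\in\mathbb{R}^{n\times p}$ with $U\mathbf{q}^*+\alpha\nabla\mathbf{f}(\mathbf{x}^* )=\mathbf{0}$ and $U\mathbf{x}^*=\mathbf{0}$), $$\|\mathbf{z}^k-\mathbf{z}^*\|_G^2-\|\mathbf{z}^{k+1}-\mathbf{z}^*\|_G^2\ \ge\ \zeta\,\|\mathbf{z}^k-\mathbf{z}^{k+1}\|_G^2,\qquad k=0,1,\ldots,$$ where $\zeta=1-\frac{\alpha L_{\mathbf f}}{2\lambda_{\min}(\tilde W)}$. Furthermore, $\mathbf{z}^k$ converges to an optimal $\mathbf{z}^*$ as $k\to\infty$.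
   Context: Setting. Consider the problem $\min_{x\in\mathbb{R}^p}\bar f(x)=\frac1n\sum_{i=1}^n f_i(x)$. For $\mathbf{x}\in\mathbb{R}^{n\times p}$ with rows $x_{(1)}^{\mathrm T},\dots,x_{(n)}^{\mathrm T}$, put $\mathbf{f}(\mathbf{x})=\sum_{i=1}^n f_i(x_{(i)})$, and let $\nabla\mathbf{f}(\mathbf{x})\in\mathbb{R}^{n\times p}$ be the matrix whose $i$-th row is $\nabla f_i(x_{(i)})^{\mathrm T}$. $\mathbf{1}\in\mathbb{R}^n$ is the all-ones vector; $\succ,\succcurlyeq$ denote the Loewner order on symmetric matrices; $\lambda_{\min}$ is the smallest eigenvalue. Assumption 1 (mixing matrices). There is a connected undirected graph with vertex set $\{1,\dots,n\}$ and edge set $\mathcal{E}$, and $W=[w_{ij}]$, $\tilde W=[\tilde w_{ij}]$ satisfy: (1) if $i\ne j$ and $(i,j)\notin\mathcal{E}$ then $w_{ij}=\tilde w_{ij}=0$; (2) $W=W^{\mathrm T}$, $\tilde W=\tilde W^{\mathrm T}$; (3) $\mathrm{null}(W-\tilde W)=\mathrm{span}\{\mathbf{1}\}$ and $\mathrm{null}(I-\tilde W)\supseteq\mathrm{span}\{\mathbf{1}\}$; (4) $\tilde W\succ0$ and $\frac{I+W}{2}\succcurlyeq\tilde W\succcurlyeq W$. Assumption 2. Each $f_i:\mathbb{R}^p\to\mathbb{R}$ is convex and differentiable with $\|\nabla f_i(x_a)-\nabla f_i(x_b)\|_2\le L_{f_i}\|x_a-x_b\|_2$ for all $x_a,x_b\in\mathbb{R}^p$,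 where $L_{f_i}\ge0$ is a constant. Assumption 3. The problem $\min_x\bar f(x)$ has a nonempty set of optimal solutions. EXTRA. Given $\alpha>0$ and $\mathbf{x}^0\in\mathbb{R}^{n\times p}$: $\mathbf{x}^1=W\mathbf{x}^0-\alpha\nabla\mathbf{f}(\mathbf{x}^0)$, and for $k=0,1,\dots$, $\mathbf{x}^{k+2}=(I+W)\mathbf{x}^{k+1}-\tilde W\mathbf{x}^k-\alpha[\nabla\mathbf{f}(\mathbf{x}^{k+1})-\nabla\mathbf{f}(\mathbf{x}^k)]$. Auxiliary objects. $U=(\tilde W-W)^{1/2}$ is the symmetric positive semidefinite square root of $\tilde W-W$; $\mathbf{q}^k=\sum_{t=0}^kU\mathbf{x}^t$; $\mathbf{z}^k=\begin{pmatrix}\mathbf{q}^k\\ \mathbf{x}^k\end{pmatrix}\in\mathbb{R}^{2n\times p}$; $G=\begin{pmatrix}I&\mathbf{0}\\ \mathbf{0}&\tilde W\end{pmatrix}$. For symmetric positive semidefinite $M$, $\|A\|_M=\sqrt{\mathrm{trace}(A^{\mathrm T}MA)}$. Convention: if $L_{\mathbf f}=0$, the step size condition is read as $\alpha>0$. *)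

(* Defs.v *)
From HB Require Import structures.
From mathcomp Require Import all_boot all_order all_algebra.
From mathcomp Require Import all_classical all_reals all_analysis.

Set Implicit Arguments.
Unset Strict Implicit.
Unset Printing Implicit Defensive.

Import Order.TTheory GRing.Theory Num.Theory.
Import numFieldNormedType.Exports.

Local Open Scope classical_set_scope.
Local Open Scope ring_scope.

(* The library norm on matrices is the max norm. *)
Definition enorm (R : realType) (p : nat) (v : 'rV[R]_p) : R :=
  Num.sqrt (\sum_(j < p) v 0 j ^+ 2).

(* The decision variable is a row vector, so that the rows x_(i)^T of a stacked
   iterate x : 'M_(n, p) are directly the arguments of the f_i. *)
Definition gradient (R : realType) (p : nat) (f : 'rV[R]_p -> R)
    (x : 'rV[R]_p) : 'rV[R]_p :=
  \row_(j < p) 'D_(delta_mx 0 j) (f : 'rV[R]_p -> R^o) x.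

Definition stacked_gradient (R : realType) (n p : nat)
    (f : 'I_n -> 'rV[R]_p -> R) (x : 'M[R]_(n, p)) : 'M[R]_(n, p) :=
  \matrix_(i < n) gradient (f i) (row i x).

Definition average (R : realType) (n p : nat) (f : 'I_n -> 'rV[R]_p -> R)
    (x : 'rV[R]_p) : R :=
  n%:R^-1 * \sum_(i < n) f i x.

Definition null_space (R : realType) (m n : nat) (A : 'M[R]_(m, n)) :
    set 'cV[R]_n :=
  [set v | A *m v = 0].

Definition span_ones (R : realType) (n : nat) : set 'cV[R]_n :=
  [set c *: const_mx 1 | c in [set: R]].
Arguments span_ones : clear implicits.

Definition psd (R : realType) (n : nat) (A : 'M[R]_n) : Prop :=
  A^T = A /\ forall v : 'cV[R]_n, 0 <= (v^T *m A *m v) 0 0.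

Definition posdef (R : realType) (n : nat) (A : 'M[R]_n) : Prop :=
  A^T = A /\ forall v : 'cV[R]_n, v != 0 -> 0 < (v^T *m A *m v) 0 0.

Definition loewner_ge (R : realType) (n : nat) (A B : 'M[R]_n) : Prop :=
  psd (A - B).

Definition is_psd_sqrt (R : realType) (n : nat) (A U : 'M[R]_n) : Prop :=
  psd U /\ U *m U = A.

(* For a symmetric matrix with n >= 1 the set of eigenvalues is finite and
   nonempty, so this infimum is its minimum. *)
Definition lambda_min (R : realType) (n : nat) (A : 'M[R]_n) : R :=
  inf [set a : R | eigenvalue A a].

Definition wnorm (R : realType) (m p : nat) (M : 'M[R]_m) (A : 'M[R]_(m, p)) : R :=
  Num.sqrt (\tr (A^T *m M *m A)).

Definition mixing_matrices (R : realType) (n : nat) (W Wt : 'M[R]_n) : Prop :=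
  (exists E : rel 'I_n,
     [/\ symmetric E,
         forall i j, connect E i j &
         forall i j, i != j -> ~~ E i j -> W i j = 0 /\ Wt i j = 0]) /\
  [/\ W^T = W,
      Wt^T = Wt,
      null_space (W - Wt) = span_ones R n,
      span_ones R n `<=` null_space (1%:M - Wt) &
      [/\ posdef Wt, loewner_ge (2^-1 *: (1%:M + W)) Wt & loewner_ge Wt W]].

Definition convex_smooth (R : realType) (p : nat) (f : 'rV[R]_p -> R) (L : R) :
    Prop :=
  [/\ convex_function [set: 'rV[R]_p] f,
      forall x : 'rV[R]_p, differentiable (f : 'rV[R]_p -> R^o) x,
      0 <= L &
      forall xa xb : 'rV[R]_p,
        enorm (gradient f xa - gradient f xb) <= L * enorm (xa - xb)].

(* The neutral element 0 is harmless: the constants L i are nonnegative. *)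
Definition Lmax (R : realType) (n : nat) (L : 'I_n -> R) : R :=
  \big[Num.max/0]_(i < n) L i.

Definition has_minimizer (R : realType) (p : nat) (g : 'rV[R]_p -> R) : Prop :=
  exists x : 'rV[R]_p, forall y : 'rV[R]_p, g x <= g y.

Definition EXTRA (R : realType) (n p : nat) (f : 'I_n -> 'rV[R]_p -> R)
    (W Wt : 'M[R]_n) (alpha : R) (x : nat -> 'M[R]_(n, p)) : Prop :=
  x 1%N = W *m x 0%N - alpha *: stacked_gradient f (x 0%N) /\
  forall k : nat,
    x k.+2 = (1%:M + W) *m x k.+1 - Wt *m x k
      - alpha *: (stacked_gradient f (x k.+1) - stacked_gradient f (x k)).

Definition qseq (R : realType) (n p : nat) (U : 'M[R]_n)
    (x : nat -> 'M[R]_(n, p)) (k : nat) : 'M[R]_(n, p) :=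
  \sum_(0 <= t < k.+1) U *m x t.

Definition zseq (R : realType) (n p : nat) (U : 'M[R]_n)
    (x : nat -> 'M[R]_(n, p)) (k : nat) : 'M[R]_(n + n, p) :=
  col_mx (qseq U x k) (x k).

Definition Gmx (R : realType) (n : nat) (Wt : 'M[R]_n) : 'M[R]_(n + n) :=
  block_mx 1%:M 0 0 Wt.

Definition optimal_pair (R : realType) (n p : nat) (f : 'I_n -> 'rV[R]_p -> R)
    (U : 'M[R]_n) (alpha : R) (q x : 'M[R]_(n, p)) : Prop :=
  U *m q + alpha *: stacked_gradient f x = 0 /\ U *m x = 0.

(* Main.v *)
Require Import Defs.
From HB Require Import structures.
From mathcomp Require Import all_boot all_order all_algebra.
From mathcomp Require Import all_classical all_reals all_analysis.
From mathcomp Require Import ring lra.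

Set Implicit Arguments.
Unset Strict Implicit.
Unset Printing Implicit Defensive.

Import Order.TTheory GRing.Theory Num.Theory.
Import numFieldNormedType.Exports.

Local Open Scope classical_set_scope.
Local Open Scope ring_scope.

(** The proof reads EXTRA as a primal-dual iteration. Summing its recursion shows
    that [q k], the accumulated disagreement, is a dual variable for the
    consensus constraint [U *m x = 0], and the step becomes
      [Wt *m (x k - x k.+1) = (I + W - 2 Wt) *m x k.+1 + U *m q k.+1
                              + alpha *: gradient at x k]
    ([extra_step]): the optimality system, evaluated at the new iterate except
    for the gradient, which is taken at the old one.

    Subtract the optimality system of [(qs, xs)] and pair with [x k.+1 - xs]. The
    left side and the [U] term assemble into the [G]-pairing of the step
    with the new error, so polarisation gives an exact formula for the decrease
    of the squared distance ([extra_identity]): the square of the step, plus a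
    term that is nonnegative since [(I + W) / 2 - Wt] is positive semidefinite,
    plus [2 alpha] times the pairing of the gradient difference at [x k] with
    [x k.+1 - xs]. If [x k] stood in place of [x k.+1], cocoercivity
    ([smooth_cocoercive]) would make that pairing nonnegative with a margin; the
    margin absorbs the mismatch [x k.+1 - x k] up to [Lmax L / 4] times its
    square, which is at most [(lambda_min Wt)^-1] times the corresponding part
    of the squared [G]-norm ([lambda_min_rayleigh]). This is the claimed inequality
    ([extra_fejer]).

    For the convergence, an optimal pair exists ([optimal_pair_exists]): stack a
    minimiser of the average, and note that its stacked gradient has zero column
    sums and so lies in the range of [U]. Since [zeta > 0], distances to optimal
    pairs decrease, the iterates stay bounded and the steps vanish. Hence
    subsequential limits are optimal ([subsequential_limit_optimal]), and
    monotonicity of the distance to such a limit forces convergence of the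
    whole sequence ([extra_cvg]). *)

(** * The Frobenius inner product *)

(** The bilinear form behind the weighted norms: the square of the M-norm of A is
    [frob A (M *m A)]. Writing the arguments as two matrices makes the
    cross terms of an expansion available, which a norm does not. *)
Definition frob (R : realType) (m p : nat) (A B : 'M[R]_(m, p)) : R :=
  \tr (A^T *m B).

Section Frobenius.
Context {R : realType}.

Lemma frobE m p (A B : 'M[R]_(m, p)) :
  frob A B = \sum_i \sum_j A i j * B i j.
Proof.
rewrite /frob /mxtrace exchange_big /=; apply: eq_bigr => j _.
by rewrite !mxE; apply: eq_bigr => i _; rewrite !mxE.
Qed.

Lemma frobC m p (A B : 'M[R]_(m, p)) : frob A B = frob B A.
Proof. by rewrite /frob -mxtrace_tr trmx_mul trmxK. Qed.

Lemma frobDr m p (A B C : 'M[R]_(m, p)) : frob A (B + C) = frob A B + frob A C.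
Proof. by rewrite /frob mulmxDr raddfD. Qed.

Lemma frobNr m p (A B : 'M[R]_(m, p)) : frob A (- B) = - frob A B.
Proof. by rewrite /frob mulmxN raddfN. Qed.

Lemma frobZr m p a (A B : 'M[R]_(m, p)) : frob A (a *: B) = a * frob A B.
Proof. by rewrite /frob -scalemxAr mxtraceZ. Qed.

Lemma frobDl m p (A B C : 'M[R]_(m, p)) : frob (A + B) C = frob A C + frob B C.
Proof. by rewrite frobC frobDr !(frobC C). Qed.

Lemma frobNl m p (A B : 'M[R]_(m, p)) : frob (- A) B = - frob A B.
Proof. by rewrite frobC frobNr frobC. Qed.

Lemma frobZl m p a (A B : 'M[R]_(m, p)) : frob (a *: A) B = a * frob A B.
Proof. by rewrite frobC frobZr frobC. Qed.

Lemma frob0r m p (A : 'M[R]_(m, p)) : frob A 0 = 0.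
Proof. by rewrite /frob mulmx0 mxtrace0. Qed.

Lemma frob_mulmx m n p (M : 'M[R]_(m, n)) (A : 'M[R]_(m, p))
    (B : 'M[R]_(n, p)) :
  frob A (M *m B) = frob (M^T *m A) B.
Proof. by rewrite /frob trmx_mul trmxK mulmxA. Qed.

Lemma frob_tr m p (A B : 'M[R]_(m, p)) : frob A^T B^T = frob A B.
Proof. by rewrite -frobC /frob trmxK mxtrace_mulC. Qed.

Lemma frob_rows m p (A B : 'M[R]_(m, p)) :
  frob A B = \sum_i frob (row i A) (row i B).
Proof.
rewrite frobE; apply: eq_bigr => i _; rewrite frobE big_ord1.
by apply: eq_bigr => j _; rewrite !mxE.
Qed.

Lemma frob_cols m p (A B : 'M[R]_(m, p)) :
  frob A B = \sum_j frob (col j A) (col j B).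
Proof.
rewrite frobE exchange_big; apply: eq_bigr => j _; rewrite frobE.
by apply: eq_bigr => i _; rewrite big_ord1 !mxE.
Qed.

Lemma col_mulmx m n p (M : 'M[R]_(m, n)) (A : 'M[R]_(n, p)) j :
  col j (M *m A) = M *m col j A.
Proof. by rewrite colE -mulmxA -colE. Qed.

Lemma frob_col_mx m n p (A B : 'M[R]_(m, p)) (C D : 'M[R]_(n, p)) :
  frob (col_mx A C) (col_mx B D) = frob A B + frob C D.
Proof. by rewrite /frob tr_col_mx mul_row_col raddfD. Qed.

Lemma sqr_entry_le_frob m p (A : 'M[R]_(m, p)) i j : A i j ^+ 2 <= frob A A.
Proof.
rewrite frobE (bigD1 i) //= (bigD1 j) //= -expr2 -addrA lerDl.
by rewrite addr_ge0 // ?sumr_ge0 // => *; rewrite ?sumr_ge0 // => *;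
   rewrite -expr2 sqr_ge0.
Qed.

Lemma frob_ge0 m p (A : 'M[R]_(m, p)) : 0 <= frob A A.
Proof.
by rewrite frobE; do 2![apply: sumr_ge0 => ? _]; rewrite -expr2 sqr_ge0.
Qed.

Lemma norm_entry_le_frob m p (A : 'M[R]_(m, p)) i j :
  `|A i j| <= frob A A + 1.
Proof.
have A0 := frob_ge0 A; rewrite -(ler_pXn2r (n := 2)) ?nnegrE ?addr_ge0 //.
rewrite -normrX ger0_norm ?sqr_ge0 //.
by apply: le_trans (sqr_entry_le_frob A i j) _; nra.
Qed.

Lemma frob_eq0 m p (A : 'M[R]_(m, p)) : (frob A A == 0) = (A == 0).
Proof.
apply/eqP/eqP => [A0|->]; last exact: frob0r.
apply/matrixP => i j; rewrite mxE; apply/eqP.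
by rewrite -sqrf_eq0 eq_le sqr_ge0 andbT -A0 sqr_entry_le_frob.
Qed.

(** The Cauchy-Schwarz inequality without square roots: expand
    [frob (A - K *: B) (A - K *: B) >= 0]. *)
Lemma frob_le_of_sqr m p (A B : 'M[R]_(m, p)) (K : R) :
  0 <= K -> frob A A <= K ^+ 2 * frob B B -> frob A B <= K * frob B B.
Proof.
rewrite le_eqVlt => /predU1P[<-|K0] AB.
  suff -> : A = 0 by rewrite frobC frob0r mul0r.
  apply/eqP; rewrite -frob_eq0 eq_le frob_ge0 andbT.
  by move: AB; rewrite expr2 !mul0r.
have := frob_ge0 (A - K *: B).
rewrite !(frobDl, frobDr, frobNl, frobNr, frobZl, frobZr) (frobC B A) => h.
by rewrite -(ler_pM2l K0); nra.
Qed.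

(** Young's inequality with the weight fixed by a cocoercivity bound on [g]:
    expand the square of [g - (K / 2) *: e], whose quadratic term in [g] is
    absorbed by [K * s]. A division by [K] is avoided so that [K = 0] is allowed,
    in which case [g] vanishes. *)
Lemma frob_young m p (e g : 'M[R]_(m, p)) (K s : R) :
  0 <= K -> 0 <= s -> frob g g <= K * s -> frob e g <= s + K / 4 * frob e e.
Proof.
rewrite le_eqVlt => /predU1P[<-|K0] s0 gs.
  have /eqP -> : g == 0 by rewrite -frob_eq0 eq_le frob_ge0 andbT -(mul0r s).
  by rewrite frob0r !mul0r addr0.
have := frob_ge0 (g - (K / 2) *: e).
rewrite !(frobDl, frobDr, frobNl, frobNr, frobZl, frobZr) (frobC g e) => h.
by rewrite -(ler_pM2l K0); nra.
Qed.

Lemma enorm_sqr p (v : 'rV[R]_p) : enorm v ^+ 2 = frob v v.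
Proof.
rewrite /enorm sqr_sqrtr; last by apply: sumr_ge0 => j _; exact: sqr_ge0.
by rewrite frobE big_ord1; apply: eq_bigr => j _; rewrite expr2.
Qed.

Lemma enorm_ge0 p (v : 'rV[R]_p) : 0 <= enorm v.
Proof. exact: sqrtr_ge0. Qed.

End Frobenius.

(** * Positive semidefinite matrices *)

Section Semidefinite.
Context {R : realType}.

Lemma psd_frob_ge0 n p (M : 'M[R]_n) (A : 'M[R]_(n, p)) :
  psd M -> 0 <= frob A (M *m A).
Proof.
move=> [_ Mge0]; rewrite frob_cols; apply: sumr_ge0 => j _.
by rewrite col_mulmx /frob mulmxA trace_mx11.
Qed.

Lemma posdef_psd n (M : 'M[R]_n) : posdef M -> psd M.
Proof.
move=> [Msym Mpos]; split=> // v.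
by have [->|/Mpos/ltW//] := eqVneq v 0; rewrite mulmx0 mxE.
Qed.

Lemma wnorm_sqr n p (M : 'M[R]_n) (A : 'M[R]_(n, p)) :
  psd M -> wnorm M A ^+ 2 = frob A (M *m A).
Proof.
move=> Mpsd; have := psd_frob_ge0 A Mpsd.
by rewrite /wnorm /frob mulmxA => /sqr_sqrtr.
Qed.

(** Near the origin the linear term dominates, so its coefficient cannot have a
    sign. *)
Lemma quadratic_ge0_linear0 (a b : R) :
  (forall t, 0 <= a * t + b * t ^+ 2) -> a = 0.
Proof.
move=> h; have b0 : 0 <= `|b| + 1 by rewrite addr_ge0.
have b1 : 0 < `|b| + 1 by rewrite ltr_pwDr.
have [//|a0] := eqVneq a 0.
(* Adding 1 keeps the divisor positive when b = 0. *)
have := h (- a / (`|b| + 1)); have := ler_norm b.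
rewrite (_ : _ + _ = (a / (`|b| + 1)) ^+ 2 * (b - (`|b| + 1))); last first.
  by field; rewrite gt_eqF.
move=> bb; rewrite pmulr_rge0; first by lra.
by rewrite exprn_even_gt0 //= mulf_neq0 // invr_eq0 gt_eqF.
Qed.

(** An isotropic [A] minimises the quadratic form of [M], hence its first
    variation vanishes; in the direction [M *m A] that variation is the square
    of the norm of [M *m A]. *)
Lemma psd_ker n p (M : 'M[R]_n) (A : 'M[R]_(n, p)) :
  psd M -> frob A (M *m A) = 0 -> M *m A = 0.
Proof.
move=> Mpsd A0; apply/eqP; rewrite -frob_eq0; apply/eqP.
have Msym := Mpsd.1.
have h t : 0 <= (2 * frob (M *m A) (M *m A)) * t
               + frob (M *m A) (M *m (M *m A)) * t ^+ 2.
  have := psd_frob_ge0 (A + t *: (M *m A)) Mpsd.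
  rewrite mulmxDr -scalemxAr !(frobDl, frobDr, frobZl, frobZr) A0.
  rewrite (frob_mulmx M A) Msym.
  by congr (0 <= _); ring.
by have /eqP := quadratic_ge0_linear0 h; rewrite mulf_eq0 pnatr_eq0 => /eqP.
Qed.

End Semidefinite.

(** * Convergence of matrices *)

Section MatrixConvergence.
Context {R : realType}.

Lemma cvg_mxP (T : Type) (F : set_system T) {FF : Filter F} m p
    (u : T -> 'M[R]_(m, p)) (a : 'M[R]_(m, p)) :
  (u t @[t --> F] --> a) <-> (forall i j, u t i j @[t --> F] --> a i j).
Proof.
split=> [ua i j|ua].
  apply: (cvg_comp u (fun A : 'M[R]_(m, p) => A i j) ua).
  exact: coord_continuous.
apply/cvgrPdist_lt => e e0.
have : \forall t \near F,
    forall ij : 'I_m * 'I_p, `|a ij.1 ij.2 - u t ij.1 ij.2| < e.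
  by apply: filter_forall => -[i j]; move/cvgrPdist_lt : (ua i j); exact.
apply: filterS => t ut; rewrite {1}/Num.norm /= mx_normrE.
by apply/bigmax_ltP; split=> // ij _; rewrite !mxE; exact: ut.
Qed.

Lemma cvg_sumr (T I : Type) (F : set_system T) {FF : Filter F} (r : seq I)
    (u : I -> T -> R) (a : I -> R) :
  (forall i, u i t @[t --> F] --> a i) ->
  \sum_(i <- r) u i t @[t --> F] --> \sum_(i <- r) a i.
Proof. by move=> ua; apply: cvg_big => //; exact: add_continuous. Qed.

Lemma cvg_mulmx (T : Type) (F : set_system T) {FF : Filter F} m n p
    (u : T -> 'M[R]_(m, n)) (v : T -> 'M[R]_(n, p))
    (a : 'M[R]_(m, n)) (b : 'M[R]_(n, p)) :
  u t @[t --> F] --> a -> v t @[t --> F] --> b ->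
  u t *m v t @[t --> F] --> a *m b.
Proof.
move=> /cvg_mxP ua /cvg_mxP vb; apply/cvg_mxP => i j.
under eq_fun do rewrite mxE.
rewrite mxE; apply: cvg_sumr => k; exact: cvgM.
Qed.

Lemma cvg_usubmx (T : Type) (F : set_system T) {FF : Filter F} m n p
    (Z : T -> 'M[R]_(m + n, p)) (a : 'M[R]_(m + n, p)) :
  Z t @[t --> F] --> a -> usubmx (Z t) @[t --> F] --> usubmx a.
Proof.
move=> /cvg_mxP Za; apply/cvg_mxP => i j; rewrite mxE.
by under eq_fun do rewrite mxE; exact: Za.
Qed.

Lemma cvg_dsubmx (T : Type) (F : set_system T) {FF : Filter F} m n p
    (Z : T -> 'M[R]_(m + n, p)) (a : 'M[R]_(m + n, p)) :
  Z t @[t --> F] --> a -> dsubmx (Z t) @[t --> F] --> dsubmx a.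
Proof.
move=> /cvg_mxP Za; apply/cvg_mxP => i j; rewrite mxE.
by under eq_fun do rewrite mxE; exact: Za.
Qed.

Lemma cvg_frob (T : Type) (F : set_system T) {FF : Filter F} m p
    (u v : T -> 'M[R]_(m, p)) (a b : 'M[R]_(m, p)) :
  u t @[t --> F] --> a -> v t @[t --> F] --> b ->
  frob (u t) (v t) @[t --> F] --> frob a b.
Proof.
move=> /cvg_mxP ua /cvg_mxP vb; under eq_fun do rewrite frobE.
by rewrite frobE; do 2![apply: cvg_sumr => ?]; exact: cvgM.
Qed.

(** All norms on matrices are equivalent: convergence may be tested on the
    Frobenius norm, which is the one the algorithm controls. *)
Lemma cvg_frob0P (T : Type) (F : set_system T) {FF : Filter F} m p
    (u : T -> 'M[R]_(m, p)) (a : 'M[R]_(m, p)) :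
  (u t @[t --> F] --> a) <-> (frob (u t - a) (u t - a) @[t --> F] --> (0 : R)).
Proof.
split=> [ua|u0].
  have uaa : u t - a @[t --> F] --> a - a by apply: cvgB ua _; exact: cvg_cst.
  rewrite -(frob0r (0 : 'M[R]_(m, p))) -[X in frob X X](subrr a).
  exact: cvg_frob.
apply/cvg_mxP => i j; apply/cvgrPdist_lt => e e0.
move/cvgrPdist_lt : u0 => /(_ (e ^+ 2)); rewrite exprn_gt0 // => /(_ isT).
apply: filterS => t; rewrite sub0r normrN ger0_norm ?frob_ge0 // => ut.
rewrite -(ltr_pXn2r (n := 2)) ?nnegrE ?normr_ge0 ?ltW // -normrX.
rewrite ger0_norm ?sqr_ge0 //.
apply: le_lt_trans ut; rewrite -sqrrN opprB.
by have := sqr_entry_le_frob (u t - a) i j; rewrite !mxE.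
Qed.

Lemma cvg_subseq (T : Type) (F : set_system T) (u : nat -> T) (h : nat -> nat) :
  (forall k, (k <= h k)%N) ->
  u k @[k --> \oo] --> F -> u (h k) @[k --> \oo] --> F.
Proof.
move=> hk; apply: (cvg_comp h u) => A [N _ NA]; exists N => // k Nk.
by apply: NA; exact: leq_trans (hk k).
Qed.

Lemma bounded_seq_subseq (u : nat -> R) (K : R) :
  (forall k, `|u k| <= K) ->
  exists2 h : nat -> nat, (forall k, (k <= h k)%N) & cvgn (u \o h).
Proof.
move=> uK; have [|h hinc hcvg] := @bolzano_weierstrass R u.
  exists K; split; first exact: num_real.
  by move=> M KM k _; exact: le_trans (ltW KM).
exists h => //; elim=> // k IH; apply: leq_ltn_trans IH _.
by move/increasing_seqP : hinc; exact.
Qed.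

(** Bolzano-Weierstrass, extracting a subsequence for one entry after another.
    The bound [k <= h k] is all that the limit arguments use of a
    subsequence. *)
Lemma bounded_mx_subseq m p (u : nat -> 'M[R]_(m, p)) (K : R) :
  (forall k i j, `|u k i j| <= K) ->
  exists2 h : nat -> nat, (forall k, (k <= h k)%N) &
    exists a : 'M[R]_(m, p), u (h k) @[k --> \oo] --> a.
Proof.
move=> uK.
have [h hk hcvg] : exists2 h : nat -> nat, (forall k, (k <= h k)%N) &
    forall ij : 'I_m * 'I_p, ij \in enum {: 'I_m * 'I_p} ->
      cvgn (fun k => u (h k) ij.1 ij.2).
  elim: (enum _) => [|ij s [h hk hcvg]]; first by exists id.
  have [//|g gk gcvg] := @bounded_seq_subseq (fun k => u (h k) ij.1 ij.2) K.
  exists (h \o g) => [k|kl]; first exact: leq_trans (gk k) (hk _).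
  rewrite inE => /predU1P[->//|/hcvg/cvg_ex[l ul]].
  by apply/cvg_ex; exists l; exact: (cvg_subseq gk ul).
exists h => //; exists (\matrix_(i, j) limn (fun k => u (h k) i j)).
apply/cvg_mxP => i j; rewrite mxE.
by apply: (hcvg (i, j)); rewrite mem_enum.
Qed.

End MatrixConvergence.

(** * The smallest eigenvalue of a symmetric matrix *)

(** The Rayleigh quotient attains its minimum [q v] on the unit sphere. Then
    [M - (q v)%:M] is positive semidefinite and [v] is isotropic for it, so [v]
    lies in its kernel: [q v] is an eigenvalue. Every eigenvalue is the Rayleigh
    quotient of its eigenvector, so [q v] is the smallest one, and the
    infimum that defines [lambda_min] is attained. *)
Lemma lambda_min_rayleigh (R : realType) n (M : 'M[R]_n) :
  (0 < n)%N -> M^T = M ->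
  eigenvalue M (lambda_min M) /\
  forall p (A : 'M[R]_(n, p)), lambda_min M * frob A A <= frob A (M *m A).
Proof.
move=> n0 Msym; pose q (v : 'rV[R]_n) := frob v (v *m M).
pose S := [set v : 'rV[R]_n | frob v v = 1].
have q_cts : continuous q.
  move=> v; apply: (@cvg_frob R _ (nbhs v) _ _ _ id (mulmx^~ M)) => //.
  by apply: (@cvg_mulmx R _ (nbhs v) _ _ _ _ id (cst M)) => //; exact: cvg_cst.
have S0 : S !=set0.
  exists (delta_mx 0 (Ordinal n0)); rewrite /S /= frobE big_ord1.
  rewrite (bigD1 (Ordinal n0)) //= big1 ?addr0; last first.
    by move=> j /negbTE j0; rewrite !mxE j0 mul0r.
  by rewrite !mxE !eqxx mulr1.
have Scompact : compact S.
  apply: bounded_closed_compact.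
    exists 1; split; first exact: real1.
    move=> K K1 v Sv; apply: le_trans (ltW K1).
    rewrite {1}/Num.norm /= mx_normrE; apply/bigmax_leP; split=> // ij _.
    rewrite -(ler_pXn2r (n := 2)) ?nnegrE // expr1n -normrX.
    by rewrite ger0_norm ?sqr_ge0 // -Sv sqr_entry_le_frob.
  apply: (@closed_comp _ _ (fun v : 'rV[R]_n => frob v v) [set 1]).
    by move=> v _; apply: (@cvg_frob R _ (nbhs v) _ _ _ id id).
  exact: closed_eq.
have [v /set_mem Sv qmin] :=
  EVT_min_rV S0 Scompact (continuous_subspaceT q_cts).
have rayleigh_row w : q v * frob w w <= q w.
  have [->|w0] := eqVneq w 0; first by rewrite /q mul0mx !frob0r mulr0.
  have ww : 0 < frob w w by rewrite lt_def frob_eq0 w0 frob_ge0.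
  pose c := Num.sqrt (frob w w).
  have cc y : c^-1 * (c^-1 * y) = y / frob w w.
    by rewrite mulrA -expr2 exprVn sqr_sqrtr ?ltW // mulrC.
  have := qmin (c^-1 *: w).
  rewrite inE /S /q /= -!scalemxAl !(frobZl, frobZr) !cc mulfV ?gt_eqF //.
  by move=> /(_ erefl); rewrite ler_pdivlMr.
have rayleigh p (A : 'M[R]_(n, p)) : q v * frob A A <= frob A (M *m A).
  rewrite (frob_cols A A) (frob_cols A (_ *m _)) mulr_sumr.
  apply: ler_sum => j _.
  rewrite col_mulmx -(frob_tr _ (M *m _)) trmx_mul Msym.
  by rewrite -(frob_tr (col j A) (col j A)); exact: rayleigh_row.
have eig : eigenvalue M (q v).
  apply/eigenvalueP; exists v; last by rewrite -frob_eq0 Sv oner_eq0.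
  apply/eqP; rewrite -subr_eq0 -mul_mx_scalar -mulmxBr -trmx_eq0 trmx_mul.
  have tr : (M - (q v)%:M)^T = M - (q v)%:M.
    by rewrite raddfB /= Msym tr_scalar_mx.
  rewrite tr; apply/eqP/psd_ker.
    split=> // w; rewrite -mulmxA -trace_mx11 -/(frob w _) mulmxBl frobDr.
    by rewrite frobNr mul_scalar_mx frobZr subr_ge0 rayleigh.
  rewrite mulmxBl frobDr frobNr mul_scalar_mx frobZr -{1}Msym -trmx_mul.
  by rewrite !frob_tr Sv mulr1 subrr.
have eig_ge a (w : 'rV[R]_n) : w *m M = a *: w -> w != 0 -> q v <= a.
  move=> wM w0; have := rayleigh_row w; rewrite /q wM frobZr ler_pM2r //.
  by rewrite lt_def frob_eq0 w0 frob_ge0.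
suff -> : lambda_min M = q v by [].
apply/eqP; rewrite eq_le; apply/andP; split.
  apply: ge_inf => //.
  exists (q v) => a /eigenvalueP[w wM w0].
  exact: eig_ge wM w0.
apply: lb_le_inf; first by exists (q v).
move=> a /eigenvalueP[w wM w0].
exact: eig_ge wM w0.
Qed.

(** * Convex functions with Lipschitz gradient *)

Section Smooth.
Context {R : realType}.

(** Directional derivatives are linear in the direction, so the partial
    derivatives collected in the gradient determine them all. *)
Lemma derive_gradient p (f : 'rV[R]_p -> R) (x d : 'rV[R]_p) :
  differentiable (f : 'rV[R]_p -> R^o) x ->
  'D_d (f : 'rV[R]_p -> R^o) x = frob (gradient f x) d.
Proof.
move=> df; rewrite deriveE // {1}(row_sum_delta d) linear_sum frobE big_ord1.
by apply: eq_bigr => j _; rewrite linearZ /= -deriveE // mxE mulrC.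
Qed.

Lemma is_derive_line p (f : 'rV[R]_p -> R) (x d : 'rV[R]_p) (t : R) :
  (forall y, differentiable (f : 'rV[R]_p -> R^o) y) ->
  is_derive t (1 : R) (fun s => f (x + s *: d) : R^o)
    (frob (gradient f (x + t *: d)) d).
Proof.
move=> df; rewrite -derive_gradient //.
(* The difference quotient of the restriction at t is that of f at x + t *: d. *)
have eqf : (fun h : R => h^-1 *: (((fun s => f (x + s *: d) : R^o) \o shift t)
      (h *: (1 : R)) - f (x + t *: d))) =
    (fun h : R => h^-1 *: (((f : 'rV[R]_p -> R^o) \o shift (x + t *: d))
      (h *: d) - f (x + t *: d))).
  apply/funext => h; rewrite /= /shift /=.
  by rewrite [h *: 1]mulr1 scalerDl addrCA addrA.
apply: DeriveDef; last by rewrite /derive eqf.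
rewrite /derivable eqf; exact: diff_derivable.
Qed.

(** The slope of the chord from [x] towards [y] is at most [f y - f x] by
    convexity, and it tends to the directional derivative. *)
Lemma gradient_ineq p (f : 'rV[R]_p -> R) (x y : 'rV[R]_p) :
  convex_function [set: 'rV[R]_p] f ->
  (forall y, differentiable (f : 'rV[R]_p -> R^o) y) ->
  f x + frob (gradient f x) (y - x) <= f y.
Proof.
move=> cf df; rewrite -lerBrDl -derive_gradient //.
have := @diff_derivable _ _ _ _ x (y - x) (df x).
move=> /cvg_ex[l fl]; rewrite /derive (cvg_lim _ fl) //.
apply: (cvgr_to_le (cvg_dnbhs_at_right fl)).
near=> t; have t0 : 0 < t by near: t; exact: nbhs_right_gt.
have t1 : t <= 1 by near: t; apply: nbhs_right_ltW.
have cfxy : f (t *: y + (1 - t) *: x) <= t * f y + (1 - t) * f x.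
  by apply: (cf (Itv01 (ltW t0) t1) y x); rewrite inE.
rewrite /shift /= [_ *: _]mulrC ler_pdivrMr //.
rewrite (_ : t *: (y - x) + x = t *: y + (1 - t) *: x); first by lra.
by rewrite scalerBr scalerBl scale1r -addrA [- _ + _]addrC.
Unshelve. all: by end_near. Qed.

Lemma smooth_lipschitz_sqr p (f : 'rV[R]_p -> R) (L : R) (x y : 'rV[R]_p) :
  convex_smooth f L ->
  frob (gradient f x - gradient f y) (gradient f x - gradient f y)
    <= L ^+ 2 * frob (x - y) (x - y).
Proof.
move=> [_ _ L0 lip]; rewrite -!enorm_sqr -exprMn.
by rewrite ler_pXn2r ?nnegrE ?mulr_ge0 ?enorm_ge0 // lip.
Qed.

(** Along the segment, the derivative of [f] minus its quadratic upper model is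
    nonpositive because the gradient at parameter [t] has moved by at most
    [L * t] times the length of [d]; the mean value theorem concludes. *)
Lemma smooth_descent p (f : 'rV[R]_p -> R) (L : R) (x d : 'rV[R]_p) :
  convex_smooth f L ->
  f (x + d) <= f x + frob (gradient f x) d + L / 2 * frob d d.
Proof.
move=> fs; have [_ df L0 _] := fs.
pose h (t : R) : R^o :=
  f (x + t *: d) - frob (gradient f x) d * t - L / 2 * frob d d * t ^+ 2.
pose dh (t : R) : R := frob (gradient f (x + t *: d)) d - frob (gradient f x) d
  - L * t * frob d d.
have hd (t : R) : is_derive t (1 : R) h (dh t).
  have fd := is_derive_line x d t df.
  apply: is_derive_eq; rewrite /dh /GRing.scale /=; lra.
have [|c /andP[c0 c1]] := @MVT R h dh 0 1 ltr01 (fun t _ => hd t).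
  by apply: derivable_within_continuous => t _; exact: ex_derive.
rewrite !bnd_simp in c0 c1.
rewrite subr0 mulr1 /h scale1r scale0r addr0 !mulr1 !mulr0 expr1n expr0n /=.
rewrite !mulr0 !subr0 mulr1.
suff : dh c <= 0 by lra.
rewrite /dh subr_le0 -frobNl -frobDl; apply: frob_le_of_sqr.
  by rewrite mulr_ge0 // ltW.
have := smooth_lipschitz_sqr (x + c *: d) x fs.
rewrite [_ - x]addrAC subrr add0r frobZl frobZr exprMn.
by rewrite [c * _]mulrA -expr2 mulrA.
Qed.

(** Both bounds on [f] are compared at [y - L^-1 *: g]: the tangent at [x] from
    below, the quadratic model at [y] from above. That point minimises the
    model minus the tangent, which is why the gain is the full
    [(2 * L)^-1] times the square of [g]. *)
Lemma gradient_ineq_smooth p (f : 'rV[R]_p -> R) (L : R) (x y : 'rV[R]_p) :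
  convex_smooth f L -> 0 < L ->
  f x + frob (gradient f x) (y - x)
    + (2 * L)^-1 *
      frob (gradient f y - gradient f x) (gradient f y - gradient f x)
  <= f y.
Proof.
move=> fs L0; set g := gradient f y - gradient f x; have [cf df _ _] := fs.
have := gradient_ineq x (y - L^-1 *: g) cf df.
have := smooth_descent y (- (L^-1 *: g)) fs.
rewrite (_ : y - _ - x = (y - x) - L^-1 *: g); last by rewrite addrAC.
rewrite [frob (gradient f x) (_ - _ *: _)]frobDr.
rewrite !(frobNl, frobNr, frobZl, frobZr) opprK.
rewrite (_ : L / 2 * _ = (2 * L)^-1 * frob g g); last first.
  by field; rewrite gt_eqF.
have gg2 : (2 * L)^-1 * frob g g = L^-1 * frob (gradient f y) g
    - L^-1 * frob (gradient f x) g - (2 * L)^-1 * frob g g.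
  have gg : frob g g = frob (gradient f y) g - frob (gradient f x) g.
    by rewrite -frobNl -frobDl.
  by rewrite -mulrBr -gg; field; rewrite gt_eqF.
lra.
Qed.

(** The Baillon-Haddad inequality: add [gradient_ineq_smooth] to itself with the
    two points exchanged, so that the function values cancel. *)
Lemma smooth_cocoercive p (f : 'rV[R]_p -> R) (L : R) (x y : 'rV[R]_p) :
  convex_smooth f L ->
  frob (gradient f x - gradient f y) (gradient f x - gradient f y)
    <= L * frob (x - y) (gradient f x - gradient f y).
Proof.
move=> fs; set g := gradient f x - gradient f y; have [_ _ + _] := fs.
rewrite le_eqVlt => /predU1P[L0|L0].
  by have := smooth_lipschitz_sqr x y fs; rewrite -L0 expr2 !mul0r.
have := gradient_ineq_smooth x y fs L0; have := gradient_ineq_smooth y x fs L0.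
rewrite /= -/g -(opprB (gradient f x)) -/g frobNl frobNr opprK.
rewrite -(opprB x y) frobNr.
move=> h1 h2; have : 2 * ((2 * L)^-1 * frob g g) <= frob (x - y) g.
  rewrite (_ : frob (x - y) g =
      frob (gradient f x) (x - y) - frob (gradient f y) (x - y)).
    move: h1 h2; move: (_ * frob g g) (frob (gradient f x) _).
    by move: (frob (gradient f y) _) (f x) (f y) => a b c d e; lra.
  by rewrite frobC frobDl frobNl.
rewrite (_ : 2 * (_ * frob g g) = frob g g / L); last by field; rewrite gt_eqF.
by rewrite ler_pdivrMr // mulrC.
Qed.

Lemma smooth_monotone p (f : 'rV[R]_p -> R) (L : R) (x y : 'rV[R]_p) :
  convex_smooth f L -> 0 <= frob (x - y) (gradient f x - gradient f y).
Proof.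
move=> [cf df _ _]; have := gradient_ineq x y cf df.
have := gradient_ineq y x cf df.
rewrite (frobC (x - y)) frobDl frobNl -(opprB x y) frobNr.
by move: (frob _ _) (frob _ _) (f x) (f y) => a b c d; lra.
Qed.

End Smooth.

(** * Stacked gradients *)

Section Stacked.
Context {R : realType} {n p : nat}.
Context (f : 'I_n -> 'rV[R]_p -> R) (L : 'I_n -> R).
Context (hf : forall i, convex_smooth (f i) (L i)).

Lemma Lmax_ge i : L i <= Lmax L.
Proof. exact: le_bigmax. Qed.

Lemma Lmax_ge0 : 0 <= Lmax L.
Proof. exact: bigmax_ge_id. Qed.

Lemma row_stacked_gradientB (x y : 'M[R]_(n, p)) i :
  row i (stacked_gradient f x - stacked_gradient f y) =
  gradient (f i) (row i x) - gradient (f i) (row i y).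
Proof. by rewrite raddfB /= !rowK. Qed.

Lemma stacked_monotone (x y : 'M[R]_(n, p)) :
  0 <= frob (x - y) (stacked_gradient f x - stacked_gradient f y).
Proof.
rewrite frob_rows; apply: sumr_ge0 => i _.
by rewrite row_stacked_gradientB raddfB /=; exact: smooth_monotone (hf i).
Qed.

(** Cocoercivity passes from the rows to the stack with the worst constant: a
    bound by [L i] may be weakened to [Lmax L] because the pairing it
    multiplies is nonnegative by monotonicity. *)
Lemma stacked_cocoercive (x y : 'M[R]_(n, p)) :
  frob (stacked_gradient f x - stacked_gradient f y)
       (stacked_gradient f x - stacked_gradient f y)
  <= Lmax L * frob (x - y) (stacked_gradient f x - stacked_gradient f y).
Proof.
rewrite frob_rows [X in Lmax L * X]frob_rows mulr_sumr; apply: ler_sum => i _.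
rewrite row_stacked_gradientB raddfB /=.
apply: le_trans (smooth_cocoercive _ _ (hf i)) _.
by apply: ler_wpM2r (Lmax_ge i); exact: smooth_monotone (hf i).
Qed.

Lemma stacked_lipschitz_sqr (x y : 'M[R]_(n, p)) :
  frob (stacked_gradient f x - stacked_gradient f y)
       (stacked_gradient f x - stacked_gradient f y)
  <= Lmax L ^+ 2 * frob (x - y) (x - y).
Proof.
rewrite frob_rows [X in Lmax L ^+ 2 * X]frob_rows mulr_sumr.
apply: ler_sum => i _; rewrite row_stacked_gradientB raddfB /=.
apply: le_trans (smooth_lipschitz_sqr _ _ (hf i)) _.
have [_ _ L0 _] := hf i.
by apply: ler_wpM2r; rewrite ?frob_ge0 // ler_pXn2r ?nnegrE ?Lmax_ge0 ?Lmax_ge.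
Qed.

Lemma cvg_stacked_gradient (T : Type) (F : set_system T) {FF : Filter F}
    (u : T -> 'M[R]_(n, p)) (a : 'M[R]_(n, p)) :
  u t @[t --> F] --> a ->
  stacked_gradient f (u t) @[t --> F] --> stacked_gradient f a.
Proof.
move=> /cvg_frob0P ua; apply/cvg_frob0P.
apply: (squeeze_cvgr _ (cvg_cst 0)
  (h := fun t => Lmax L ^+ 2 * frob (u t - a) (u t - a))).
  by apply: nearW => t; rewrite frob_ge0 stacked_lipschitz_sqr.
by rewrite -(mulr0 (Lmax L ^+ 2)); apply: cvgMr.
Qed.

(** First-order optimality. A step of length [t] against the sum [g] of the
    gradients changes the sum of the functions by at most [- t + C * t ^+ 2]
    times the square of [g]; for [t = (C + 1)^-1] this factor is [- t ^+ 2]. *)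
Lemma minimizer_gradient0 (xm : 'rV[R]_p) :
  (0 < n)%N -> (forall y, average f xm <= average f y) ->
  \sum_i gradient (f i) xm = 0.
Proof.
move=> n0 xmin; set g := \sum_i _; pose C := \sum_i L i / 2.
have C0 : 0 <= C.
  by apply: sumr_ge0 => i _; have [_ _ L0 _] := hf i; rewrite divr_ge0.
have sum_min y : \sum_i f i xm <= \sum_i f i y.
  by have := xmin y; rewrite /average ler_pM2l // invr_gt0 ltr0n.
pose t := (C + 1)^-1; have t0 : 0 < t by rewrite invr_gt0 ltr_pwDr.
have descent_sum d : \sum_i f i (xm + d) <=
    \sum_i f i xm + frob g d + C * frob d d.
  rewrite /C mulr_suml (_ : frob g d = \sum_i frob (gradient (f i) xm) d).
    by rewrite -!big_split; apply: ler_sum => i _; exact: smooth_descent (hf i).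
  by rewrite /g; elim/big_rec2 : _ => [|i y1 y2 _ <-];
    rewrite ?frobDl // frobC frob0r.
have := le_trans (sum_min _) (descent_sum (- (t *: g))).
rewrite frobNr frobNl frobNr !frobZl !frobZr opprK -addrA lerDl.
rewrite (_ : _ + _ = - (t ^+ 2 * frob g g)); last first.
  by rewrite /t; field; rewrite gt_eqF // ltr_pwDr.
rewrite oppr_ge0 pmulr_rle0 ?exprn_gt0 // => g0.
by apply/eqP; rewrite -frob_eq0 eq_le g0 frob_ge0.
Qed.

End Stacked.

(** * Mixing matrices *)

Section Mixing.
Context {R : realType} {n : nat}.
Context (W Wt U : 'M[R]_n).
Context (hW : mixing_matrices W Wt) (hU : is_psd_sqrt (Wt - W) U).

Let gap : 'M[R]_n := 2^-1 *: (1%:M + W) - Wt.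

Lemma sqrt_sym : U^T = U. Proof. by case: hU => -[]. Qed.

Lemma sqrt_mulmx p (X : 'M[R]_(n, p)) : U *m (U *m X) = Wt *m X - W *m X.
Proof. by rewrite mulmxA (proj2 hU) mulmxBl. Qed.

(** [U] and [U *m U = Wt - W] have the same kernel, the consensus line. *)
Lemma sqrt_ker_cols p (X : 'M[R]_(n, p)) j :
  U *m X = 0 -> exists c : R, col j X = c *: const_mx 1.
Proof.
move=> UX; have [_ [_ _ nullW _ _]] := hW.
have : null_space (W - Wt) (col j X).
  rewrite /null_space /= -col_mulmx -opprB mulNmx mulmxBl -sqrt_mulmx UX.
  by rewrite mulmx0 oppr0 col0.
by rewrite nullW => -[c _ <-]; exists c.
Qed.

Lemma consensus_fixed p (X : 'M[R]_(n, p)) : U *m X = 0 -> Wt *m X = X.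
Proof.
move=> UX; apply/eqP; rewrite eq_sym -subr_eq0 -{1}(mul1mx X) -mulmxBl.
apply/eqP/matrixP => i j; have [_ [_ _ _ spanWt _]] := hW.
have [c Xj] := sqrt_ker_cols j UX.
have : null_space (1%:M - Wt) (col j X) by apply: spanWt; exists c.
by rewrite /null_space /= -col_mulmx => /colP/(_ i); rewrite !mxE.
Qed.

(** On the consensus line all of [W], [Wt] and the identity agree, so the gap
    that appears in the iteration does not disturb optimality. *)
Lemma consensus_gap0 p (X : 'M[R]_(n, p)) : U *m X = 0 -> gap *m X = 0.
Proof.
move=> UX; have WtX := consensus_fixed UX.
have WX : W *m X = X.
  by have := sqrt_mulmx X; rewrite UX mulmx0 WtX => /esym/subr0_eq.
rewrite /gap mulmxBl -scalemxAl mulmxDl mul1mx WX WtX.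
by apply/matrixP => i j; rewrite !mxE; field.
Qed.

Lemma sqrt_ones : U *m (const_mx 1 : 'cV[R]_n) = 0.
Proof.
have [_ [_ _ nullW _ _]] := hW.
have : null_space (W - Wt) (const_mx 1 : 'cV[R]_n).
  by rewrite nullW; exists 1 => //; rewrite scale1r.
rewrite /null_space /= mulmxBl => /subr0_eq W1.
apply/eqP; rewrite -frob_eq0 -{1}sqrt_sym -frob_mulmx sqrt_mulmx W1 subrr.
by rewrite frob0r.
Qed.

(** [U] is symmetric, so its range is the orthogonal complement of its kernel,
    the span of the all-ones vector. Concretely, the columns of [cokermx U] lie
    in that kernel, hence are constant, and are killed by [B^T]. *)
Lemma sqrt_range p (B : 'M[R]_(n, p)) :
  (forall j, \sum_i B i j = 0) -> exists Q : 'M[R]_(n, p), U *m Q = B.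
Proof.
move=> Bsum; have : (B^T <= U)%MS.
  rewrite submxE; apply/eqP/matrixP => j k; rewrite !mxE.
  have [c Uk] := sqrt_ker_cols k (mulmx_coker U).
  transitivity (c * \sum_i B i j); last by rewrite Bsum mulr0.
  rewrite mulr_sumr; apply: eq_bigr => i _; rewrite mxE mulrC; congr (_ * _).
  by have /colP/(_ i) := Uk; rewrite !mxE mulr1.
by move=> /submxP[D BD]; exists D^T; rewrite -[B]trmxK BD trmx_mul sqrt_sym.
Qed.

Lemma lambda_min_gt0 : (0 < n)%N -> 0 < lambda_min Wt.
Proof.
move=> n0; have [_ [_ Wtsym _ _ [[_ Wtpos] _ _]]] := hW.
have [/eigenvalueP[v vWt v0] _] := lambda_min_rayleigh n0 Wtsym.
have := Wtpos v^T; rewrite trmx_eq0 => /(_ v0).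
rewrite trmxK vWt -scalemxAl mxE -trace_mx11 -{1}[v]trmxK -/(frob _ _).
by rewrite pmulr_lgt0 // lt_def frob_eq0 trmx_eq0 v0 frob_ge0.
Qed.

Lemma Gmx_psd : psd (Gmx Wt).
Proof.
have [_ [_ Wtsym _ _ [/posdef_psd Wtpsd _ _]]] := hW.
split=> [|v]; first by rewrite /Gmx tr_block_mx !trmx0 trmx1 Wtsym.
rewrite -mulmxA -trace_mx11 -/(frob _ _) -[v]vsubmxK mul_block_col.
rewrite !mul0mx mul1mx addr0 add0r frob_col_mx.
by rewrite addr_ge0 ?frob_ge0 ?psd_frob_ge0.
Qed.

Lemma frob_Gmx p (a b c d : 'M[R]_(n, p)) :
  frob (col_mx a b) (Gmx Wt *m col_mx c d) = frob a c + frob b (Wt *m d).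
Proof.
by rewrite /Gmx mul_block_col !mul0mx mul1mx addr0 add0r frob_col_mx.
Qed.

(** Control in the [G]-norm is control of the iterates themselves. *)
Lemma Gmx_coercive p : (0 < n)%N ->
  forall Z : 'M[R]_(n + n, p),
    Num.min 1 (lambda_min Wt) * frob Z Z <= frob Z (Gmx Wt *m Z).
Proof.
move=> n0 Z; have [_ [_ Wtsym _ _ _]] := hW.
rewrite -[Z]vsubmxK frob_Gmx frob_col_mx mulrDr lerD //.
  by rewrite ler_piMl ?frob_ge0 // ge_min lexx.
apply: le_trans ((lambda_min_rayleigh n0 Wtsym).2 _ _).
by rewrite ler_wpM2r ?frob_ge0 // ge_min lexx orbT.
Qed.

End Mixing.

(** * The EXTRA iteration *)

Section Extra.
Context {R : realType} {n p : nat}.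
Context (f : 'I_n -> 'rV[R]_p -> R) (L : 'I_n -> R) (W Wt U : 'M[R]_n).
Context (alpha : R) (x : nat -> 'M[R]_(n, p)).
Context (n0 : (0 < n)%N) (hW : mixing_matrices W Wt)
  (hf : forall i, convex_smooth (f i) (L i)) (hmin : has_minimizer (average f))
  (hU : is_psd_sqrt (Wt - W) U) (hx : EXTRA f W Wt alpha x)
  (halpha0 : 0 < alpha)
  (halpha : Lmax L != 0 -> alpha < 2 * lambda_min Wt / Lmax L).

Let gap : 'M[R]_n := 2^-1 *: (1%:M + W) - Wt.
Let q := qseq U x.
Let z := zseq U x.
Let zeta := 1 - alpha * Lmax L / (2 * lambda_min Wt).
Let gradf := stacked_gradient f.
Let sqG (Z : 'M[R]_(n + n, p)) := frob Z (Gmx Wt *m Z).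

Lemma qseqS k : q k.+1 = q k + U *m x k.+1.
Proof. by rewrite /q /qseq big_nat_recr. Qed.

(** The two-step recursion telescopes to a one-step recursion whose memory is
    [q k]: the accumulated disagreement acts as a dual variable for the
    consensus constraint. *)
Lemma extra_primal_dual k :
  x k.+1 = Wt *m x k - U *m q k - alpha *: gradf (x k).
Proof.
have [x1 xS] := hx; elim: k => [|k IH].
  rewrite x1 /q /qseq big_nat1 (sqrt_mulmx hU).
  by rewrite opprB [Wt *m _ + _]addrC subrK.
rewrite xS qseqS mulmxDr (sqrt_mulmx hU) mulmxDl mul1mx -/gradf {1}IH.
move: (Wt *m x k) (Wt *m x k.+1) (W *m x k.+1) (U *m q k) => a b c d.
move: (gradf _) (gradf _) => u v.
by apply/matrixP => i j; rewrite !mxE; ring.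
Qed.

(** The recursion written so that its right-hand side is the optimality system:
    when the iterates stop moving and [U *m x k] vanishes, it says that
    [(q k, x k)] is optimal. The gap is evaluated at the new iterate and the
    gradient at the old one. *)
Lemma extra_step k :
  Wt *m (x k - x k.+1) =
  2 *: (gap *m x k.+1) + U *m q k.+1 + alpha *: gradf (x k).
Proof.
rewrite qseqS (mulmxDr U) (sqrt_mulmx hU) mulmxBr /gap mulmxBl -scalemxAl.
rewrite mulmxDl mul1mx.
rewrite [X in 2 *: (_ *: (X + _) - _)]extra_primal_dual.
move: (Wt *m x k) (Wt *m x k.+1) (W *m x k.+1) (U *m q k) => a b c d.
by apply/matrixP => i j; rewrite !mxE; field.
Qed.

(** Stack a minimiser of the average: the columns of the stacked gradient sum to
    zero, so the gradient lies in the range of [U]. *)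
Lemma optimal_pair_exists : exists qs xs, optimal_pair f U alpha qs xs.
Proof.
have [xm xmin] := hmin.
pose xs : 'M[R]_(n, p) := \matrix_(i < n) xm.
have [qs Uqs] : exists Q, U *m Q = - (alpha *: gradf xs).
  apply: (sqrt_range hW hU) => j.
  under eq_bigr do rewrite !mxE.
  rewrite sumrN -mulr_sumr.
  have /rowP/(_ j) := minimizer_gradient0 hf n0 xmin.
  rewrite summxE mxE => g0.
  rewrite (eq_bigr (fun i => gradient (f i) xm 0 j)) ?g0 ?mulr0 ?oppr0 //.
  move=> i _.
  by rewrite rowK [in RHS]mxE.
exists qs, xs; split; first by rewrite Uqs addNr.
rewrite (_ : xs = const_mx 1 *m xm) ?mulmxA ?(sqrt_ones hW hU) ?mul0mx //.
by apply/matrixP => i j; rewrite !mxE big_ord1 !mxE mul1r.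
Qed.

(** Polarisation: the difference of the squares of two vectors is the square of
    their difference plus twice its pairing with the second one. The pairing is
    computed from [extra_step] minus the optimality system of [(qs, xs)]; the
    terms with [U] cancel because the dual increment is [U *m (x k.+1 - xs)]. *)
Lemma extra_identity qs xs k : optimal_pair f U alpha qs xs ->
  sqG (z k - col_mx qs xs) - sqG (z k.+1 - col_mx qs xs) =
  sqG (z k - z k.+1)
  + 4 * frob (x k.+1 - xs) (gap *m (x k.+1 - xs))
  + 2 * alpha * frob (x k.+1 - xs) (gradf (x k) - gradf xs).
Proof.
move=> [qsxs Uxs].
have [_ [_ Wtsym _ _ _]] := hW.
have Exs : gap *m xs = 0 by exact: (consensus_gap0 hW hU Uxs).
pose e := x k - x k.+1; pose dx := x k.+1 - xs; pose dq := q k.+1 - qs.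
have xk : x k - xs = e + dx by rewrite /e /dx addrA subrK.
have qk : q k - qs = dq - U *m dx.
  rewrite /dq /dx mulmxBr Uxs subr0 qseqS.
  by rewrite addrAC addrK.
have qkk : q k - q k.+1 = - (U *m dx).
  by rewrite /dx mulmxBr Uxs subr0 qseqS opprD addNKr.
have step : Wt *m e =
    2 *: (gap *m dx) + U *m dq + alpha *: (gradf (x k) - gradf xs).
  rewrite /e extra_step /dx /dq !mulmxBr Exs subr0.
  have -> : U *m qs = - (alpha *: gradf xs).
    by apply/eqP; rewrite -addr_eq0 qsxs.
  move: (gap *m _) (U *m _) (gradf _) (gradf _) => a b c d.
  by apply/matrixP => i j; rewrite !mxE; ring.
rewrite /z /zseq -/q !opp_col_mx !add_col_mx /sqG !frob_Gmx.
rewrite -/e -/dx -/dq xk qk qkk.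
(* With visible bodies, the expansion rules for frob would split dx and dq. *)
have Usym := sqrt_sym hU; clearbody e dx dq.
have key : frob dx (Wt *m e) = 2 * frob dx (gap *m dx) + frob (U *m dx) dq
    + alpha * frob dx (gradf (x k) - gradf xs).
  rewrite step; move: (gradf _ - _) => g.
  by rewrite !frobDr !frobZr (frob_mulmx U) Usym.
have sym : frob e (Wt *m dx) = frob dx (Wt *m e).
  by rewrite frob_mulmx Wtsym frobC.
rewrite mulmxDr; move: (gradf _ - _) key => g key.
rewrite !(frobDl, frobDr, frobNl, frobNr) sym key (frobC dq); ring.
Qed.

(** In [extra_identity] the gradient is taken at [x k] but paired with
    [x k.+1 - xs]. Cocoercivity at [x k] pays for this mismatch up to
    [Lmax L / 4] times the square of the step, which [lambda_min Wt] converts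
    into a fraction [1 - zeta] of the square of the [G]-norm of the step. *)
Lemma extra_fejer qs xs k : optimal_pair f U alpha qs xs ->
  zeta * sqG (z k - z k.+1) <=
  sqG (z k - col_mx qs xs) - sqG (z k.+1 - col_mx qs xs).
Proof.
move=> opt; rewrite (extra_identity k opt).
have [_ [_ Wtsym _ _ [_ Epsd _]]] := hW.
have lam0 := lambda_min_gt0 hW n0.
have gap_ge0 := psd_frob_ge0 (x k.+1 - xs) Epsd.
set g := gradf (x k) - gradf xs; set e := x k - x k.+1.
have young : frob e g <= frob (x k - xs) g + Lmax L / 4 * frob e e.
  apply: frob_young; first exact: Lmax_ge0.
    exact: stacked_monotone.
  exact: stacked_cocoercive.
have dxg : frob (x k.+1 - xs) g = frob (x k - xs) g - frob e g.
  by rewrite -frobNl -frobDl /e opprB [in RHS]addrC addrA subrK.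
have eN : lambda_min Wt * frob e e <= sqG (z k - z k.+1).
  rewrite /sqG /z /zseq opp_col_mx add_col_mx frob_Gmx.
  apply: le_trans ((lambda_min_rayleigh n0 Wtsym).2 _ _) _.
  by rewrite lerDr frob_ge0.
have aL : 0 <= alpha * Lmax L / (2 * lambda_min Wt).
  by rewrite divr_ge0 ?mulr_ge0 ?Lmax_ge0 // ltW.
have := ler_wpM2l aL eN.
rewrite (_ : _ * (lambda_min Wt * _) =
    2 * alpha * (Lmax L / 4 * frob e e)); last first.
  by field; rewrite gt_eqF.
have := ler_wpM2l (_ : 0 <= 2 * alpha) young.
rewrite mulr_ge0 ?(ltW halpha0) // => /(_ isT).
rewrite dxg /zeta /gap mulrBl mul1r; lra.
Qed.

Lemma zeta_gt0 : 0 < zeta.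
Proof.
have lam0 := lambda_min_gt0 hW n0.
rewrite /zeta subr_gt0; have [->|L0] := eqVneq (Lmax L) 0.
  by rewrite mulr0 mul0r.
have Lpos : 0 < Lmax L by rewrite lt_def L0 Lmax_ge0.
by rewrite ltr_pdivrMr ?mulr_gt0 // mul1r -ltr_pdivlMr // halpha.
Qed.

Lemma sqG_ge0 Z : 0 <= sqG Z.
Proof. exact: psd_frob_ge0 (Gmx_psd hW). Qed.

Lemma sqG_cvg0 (T : Type) (F : set_system T) {FF : Filter F}
    (Z : T -> 'M[R]_(n + n, p)) (a : 'M[R]_(n + n, p)) :
  sqG (Z t - a) @[t --> F] --> (0 : R) -> Z t @[t --> F] --> a.
Proof.
move=> Z0; apply/cvg_frob0P.
have c0 : 0 < Num.min 1 (lambda_min Wt).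
  by rewrite lt_min ltr01 (lambda_min_gt0 hW n0).
apply: (squeeze_cvgr _ (cvg_cst 0)
  (h := fun t => (Num.min 1 (lambda_min Wt))^-1 * sqG (Z t - a))).
  apply: nearW => t; rewrite frob_ge0 mulrC ler_pdivlMr // mulrC.
  exact: (Gmx_coercive hW).
by rewrite -(mulr0 (Num.min 1 (lambda_min Wt))^-1); apply: cvgMr.
Qed.

Lemma extra_noninc qs xs : optimal_pair f U alpha qs xs ->
  nonincreasing_seq (fun k => sqG (z k - col_mx qs xs)).
Proof.
move=> opt; apply/nonincreasing_seqP => k; rewrite -subr_ge0.
apply: le_trans (extra_fejer k opt).
by rewrite mulr_ge0 ?sqG_ge0 // ltW ?zeta_gt0.
Qed.

(** The distance to any optimal pair is nonincreasing, hence converges, and its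
    decrements dominate the squares of the steps. *)
Lemma extra_steps_vanish : z k - z k.+1 @[k --> \oo] --> (0 : 'M[R]_(n + n, p)).
Proof.
have [qs [xs opt]] := optimal_pair_exists.
pose V k := sqG (z k - col_mx qs xs).
have /cvg_ex[l Vl] : cvgn V.
  apply: nonincreasing_is_cvgn; first exact: extra_noninc.
  by exists 0 => _ [k _ <-]; exact: sqG_ge0.
have Vl1 : V k.+1 @[k --> \oo] --> l by rewrite -(cvg_shiftS V) in Vl.
apply: sqG_cvg0.
apply: (squeeze_cvgr _ (cvg_cst 0) (h := fun k => zeta^-1 * (V k - V k.+1))).
  apply: nearW => k; rewrite subr0 sqG_ge0 mulrC ler_pdivlMr ?zeta_gt0 // mulrC.
  exact: extra_fejer.
by rewrite -(mulr0 zeta^-1) -(subrr l); apply: cvgMr; apply: cvgB.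
Qed.

(** As the steps vanish, [z (h k).+1] has the same limit as [z (h k)], so both
    iterates in [extra_step] and in the update of [q] may be replaced by the
    limit. *)
Lemma subsequential_limit_optimal (h : nat -> nat) (a : 'M[R]_(n + n, p)) :
  (forall k, (k <= h k)%N) -> z (h k) @[k --> \oo] --> a ->
  optimal_pair f U alpha (usubmx a) (dsubmx a).
Proof.
move=> hk za.
have za1 : z (h k).+1 @[k --> \oo] --> a.
  rewrite -[a]subr0.
  rewrite (_ : (fun k => _) = fun k => z (h k) - (z (h k) - z (h k).+1)).
    exact: cvgB za (cvg_subseq hk extra_steps_vanish).
  by apply/funext => k; rewrite opprB addrC subrK.
have xa : x (h k) @[k --> \oo] --> dsubmx a.
  rewrite (_ : (fun k => _) = fun k => dsubmx (z (h k))).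
    exact: cvg_dsubmx.
  by apply/funext => k; rewrite col_mxKd.
have xa1 : x (h k).+1 @[k --> \oo] --> dsubmx a.
  rewrite (_ : (fun k => _) = fun k => dsubmx (z (h k).+1)).
    exact: cvg_dsubmx.
  by apply/funext => k; rewrite col_mxKd.
have qa : q (h k) @[k --> \oo] --> usubmx a.
  rewrite (_ : (fun k => _) = fun k => usubmx (z (h k))).
    exact: cvg_usubmx.
  by apply/funext => k; rewrite col_mxKu.
have qa1 : q (h k).+1 @[k --> \oo] --> usubmx a.
  rewrite (_ : (fun k => _) = fun k => usubmx (z (h k).+1)).
    exact: cvg_usubmx.
  by apply/funext => k; rewrite col_mxKu.
have mul (M : 'M[R]_n) (u : nat -> 'M[R]_(n, p)) (b : 'M[R]_(n, p)) :
    u k @[k --> \oo] --> b -> M *m u k @[k --> \oo] --> M *m b.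
  by move=> ub; apply: (cvg_mulmx (cvg_cst M) ub).
have Ux : U *m dsubmx a = 0.
  have Uxa := mul U _ _ xa1.
  have : U *m x (h k).+1 @[k --> \oo] --> usubmx a - usubmx a.
    rewrite (_ : (fun k => _) = fun k => q (h k).+1 - q (h k)).
      exact: cvgB.
    by apply/funext => k; rewrite qseqS addrC addKr.
  by rewrite subrr => /(cvg_unique _ Uxa); apply.
split=> //.
(* Both sides of extra_step converge, the left one to 0. *)
have lhs : Wt *m (x (h k) - x (h k).+1) @[k --> \oo] --> (0 : 'M[R]_(n, p)).
  by rewrite -(mulmx0 _ Wt) -(subrr (dsubmx a)); apply: mul; exact: cvgB.
have rhs : 2 *: (gap *m x (h k).+1) + U *m q (h k).+1 + alpha *: gradf (x (h k))
    @[k --> \oo] -->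
    2 *: (gap *m dsubmx a) + U *m usubmx a + alpha *: gradf (dsubmx a).
  apply: cvgD; first by apply: cvgD; [apply: cvgZr; exact: mul|exact: mul].
  by apply: cvgZr; apply: (cvg_stacked_gradient hf xa).
rewrite (_ : (fun k => _) = fun k => 2 *: (gap *m x (h k).+1) + U *m q (h k).+1
  + alpha *: gradf (x (h k))) in lhs; last first.
  by apply/funext => k; exact: extra_step.
have := cvg_unique _ rhs lhs.
by rewrite (consensus_gap0 hW hU Ux) scaler0 add0r; apply.
Qed.

(** Opial's argument: the iterates are bounded, a subsequence converges to some
    optimal pair, and since the distance to that very pair is nonincreasing the
    whole sequence converges to it. *)
Lemma extra_cvg : exists qs xs : 'M[R]_(n, p),
  optimal_pair f U alpha qs xs /\ z k @[k --> \oo] --> col_mx qs xs.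
Proof.
have [qs [xs opt]] := optimal_pair_exists.
pose c := Num.min 1 (lambda_min Wt).
have c0 : 0 < c by rewrite lt_min ltr01 (lambda_min_gt0 hW n0).
pose Z0 := col_mx qs xs.
pose B := c^-1 * sqG (z 0 - Z0).
have bound k : frob (z k - Z0) (z k - Z0) <= B.
  rewrite /B mulrC ler_pdivlMr // mulrC.
  apply: le_trans (Gmx_coercive hW n0 _) _.
  exact: (extra_noninc opt (leq0n k)).
have [|h hk [a za]] :=
    @bounded_mx_subseq R _ _ z ((B + 1) + (frob Z0 Z0 + 1)).
  move=> k i j; rewrite -[z k](subrK Z0) mxE.
  apply: le_trans (ler_normD _ _) _; apply: lerD (norm_entry_le_frob _ _ _).
  by apply: le_trans (norm_entry_le_frob _ _ _) _; rewrite lerD2r bound.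
have opta := subsequential_limit_optimal hk za.
exists (usubmx a), (dsubmx a); split => //.
apply: sqG_cvg0; rewrite vsubmxK.
have Vh : sqG (z (h k) - a) @[k --> \oo] --> (0 : R).
  have za0 : z (h k) - a @[k --> \oo] --> a - a.
    by apply: cvgB => //; exact: cvg_cst.
  rewrite -(frob0r (a - a)) -(mulmx0 p (Gmx Wt)) -(subrr a).
  by apply: (cvg_frob za0); apply: cvg_mulmx za0; exact: cvg_cst.
have := extra_noninc opta; rewrite vsubmxK => noninc.
apply/cvgrPdist_lt => e e0.
move/cvgrPdist_lt : Vh => /(_ e e0) [N _ /(_ N (leqnn N))] /=.
rewrite sub0r normrN ger0_norm ?sqG_ge0 // => hN.
exists (h N) => // k hNk /=; rewrite sub0r normrN ger0_norm ?sqG_ge0 //.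
by apply: le_lt_trans hN; exact: noninc.
Qed.

End Extra.

Theorem theorem3p3 (R : realType) (n p : nat) (hn : (1 <= n)%N) (hp : (1 <= p)%N)
  (f : 'I_n -> 'rV[R]_p -> R) (L : 'I_n -> R) (W Wt U : 'M[R]_n)
  (alpha : R) (x : nat -> 'M[R]_(n, p))
  (hW : mixing_matrices W Wt)
  (hf : forall i : 'I_n, convex_smooth (f i) (L i))
  (hmin : has_minimizer (average f))
  (hU : is_psd_sqrt (Wt - W) U)
  (hx : EXTRA f W Wt alpha x)
  (halpha0 : 0 < alpha)
  (halpha : Lmax L != 0 -> alpha < 2 * lambda_min Wt / Lmax L) :
  let z := zseq U x in
  let G := Gmx Wt in
  let zeta := 1 - alpha * Lmax L / (2 * lambda_min Wt) in
  (forall qs xs : 'M[R]_(n, p), optimal_pair f U alpha qs xs ->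
     forall k : nat,
       wnorm G (z k - col_mx qs xs) ^+ 2 - wnorm G (z k.+1 - col_mx qs xs) ^+ 2
         >= zeta * wnorm G (z k - z k.+1) ^+ 2) /\
  (exists qs xs : 'M[R]_(n, p), optimal_pair f U alpha qs xs /\
     z k @[k --> \oo] --> col_mx qs xs).
Proof.
move=> z G zeta; split; last first.
  exact: (extra_cvg hn hW hf hmin hU hx halpha0 halpha).
move=> qs xs opt k; rewrite !(wnorm_sqr _ (Gmx_psd hW)).
exact: (extra_fejer hn hW hf hU hx halpha0).
Qed.
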